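(* Let $\eta_1$ and $\eta_2$ be equivalent groupoid metrics on the same Lie groupoid $G\rightrightarrows M$. Then $\eta_1$ and $\eta_2$ yield the same normal pseudo-distance $d_N$ on the coarse orbit space $M/G$.
   Context: Lie groupoids: $G\rightrightarrows M$ has manifolds $M$ of objects and $G$ of arrows ($G$ possibly non-Hausdorff), surjective submersions $s,t:G\to M$ (source, target), a smooth multiplication $m$ on $G^{(2)}=\{(g,h):s(g)=t(h)\}$, units and inverses. $O_x\subset M$ is the orbit of $x$, $M/G$ the coarse orbit space, $[x]\in M/G$ the class of $x$, and $N_xO=T_xM/T_xO_x$. Groupoid metrics: a metric on the total space of a submersion is transverse to the submersion if it descends to a metric on the base making it a Riemannian submersion. A groupoid metric on $G\rightrightarrows M$ is a Riemannian metric $\eta=\eta^{(2)}$ on $G^{(2)}$, invariant under the $S_3$-action that permutes the vertices of commutative triangles (generated by $(g,h)\mapsto(h^{-1},g^{-1})$ and $(g,h)\mapsto(gh,h^{-1})$), and transverse to $m$. It induces metrics $\eta^{(1)}$ on $G$ and $\eta^{(0)}$ on $M$ for which $m$ and the two projections $G^{(2)}\to G$, and $s,t:G\to M$, are Riemannian submersions. $\eta^{(0)}$ induces inner products on the spaces $N_xO\cong (T_xO_x)^\perp$. Two groupoid metrics are equivalent if they induce the same inner product on $N_xO$ for every $x\in M$. Normal pseudo-distance of $\eta$: let $d$ be the Riemannian distance of $\eta^{(0)}$ on each component of $M$. A chain from $x$ to $y$ is a sequence $(x_0,\dots,x_{2n+1})$ in $M$ with $x_0=x$, $x_{2n+1}=y$,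 $x_{2i},x_{2i+1}$ in the same orbit, and $x_{2i-1},x_{2i}$ in the same component of $M$. Then $d_N([x],[y])=\inf\{\sum_{i=1}^n d(x_{2i-1},x_{2i})\}$ over all chains from $x$ to $y$ (with value $+\infty$ if there is no chain, which does not happen when $M/G$ is connected). *)

(* Defs.v *)
From HB Require Import structures.
From mathcomp Require Import all_boot all_order all_algebra.
From mathcomp Require Import all_classical all_reals all_analysis.
Set Implicit Arguments.
Unset Strict Implicit.
Unset Printing Implicit Defensive.
Import Order.TTheory GRing.Theory Num.Theory.
Import numFieldNormedType.Exports.
Local Open Scope classical_set_scope.
Local Open Scope ring_scope.

(* C^k on an open set, by recursion on the directional derivatives.  This is
   the usual notion when V is finite-dimensional, the only case used below. *)
Fixpoint Ck_on (R : realType) (V W : normedModType R) (k : nat)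
    (U : set V) (f : V -> W) : Prop :=
  match k with
  | 0 => forall x, U x -> {for x, continuous f}
  | j.+1 => (forall x, U x -> differentiable f x) /\
            (forall v, Ck_on j U (fun x => 'D_v f x))
  end.

Definition smooth_on (R : realType) (V W : normedModType R)
    (U : set V) (f : V -> W) : Prop := forall k, Ck_on k U f.

(* Charts have values in R^n = 'rV[R]_n; cmap and cinv are total functions
   which are meaningful only on cdom and on its image. *)
Record chart (R : realType) (n : nat) (M : topologicalType) := Chart {
  cdom : set M;
  cmap : M -> 'rV[R]_n;
  cinv : 'rV[R]_n -> M;
  cdom_open : open cdom;
  cimg_open : open (cmap @` cdom);
  cmapK : forall x, cdom x -> cinv (cmap x) = x;
  cmap_cont : forall x, cdom x -> {for x, continuous cmap};
  cinv_cont : forall u, (cmap @` cdom) u -> {for u, continuous cinv}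
}.

(* Second countable but not necessarily Hausdorff.  As usual the dimension is
   constant on the manifold.  The chart chart_at x is a preferred chart at x:
   it serves to represent the tangent space at x. *)
Record manifold (R : realType) := Manifold {
  carrier :> topologicalType;
  dim : nat;
  atlas : set (chart R dim carrier);
  chart_at : carrier -> chart R dim carrier;
  chart_at_atlas : forall x, atlas (chart_at x);
  chart_at_dom : forall x, cdom (chart_at x) x;
  atlas_compat : forall c c', atlas c -> atlas c' ->
    smooth_on (cmap c @` (cdom c `&` cdom c')) (cmap c' \o cinv c);
  manifold_second_countable : @second_countable carrier
}.

(* T_xM, for every point x of M: the coordinate space of chart_at x. *)
Notation tangent M := 'rV_(dim M).

Section Manifolds.
Context {R : realType}.
Implicit Types M N : manifold R.

Definition smooth M N (f : M -> N) : Prop :=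
  continuous f /\
  forall c c', atlas c -> atlas c' ->
    smooth_on (cmap c @` (cdom c `&` f @^-1` cdom c'))
              (cmap c' \o f \o cinv c).

(* d_x f : T_xM -> T_(f x)N. *)
Definition mdiff M N (f : M -> N) (x : M) : tangent M -> tangent N :=
  'd (cmap (chart_at (f x)) \o f \o cinv (chart_at x)) (cmap (chart_at x) x).

Definition submersion M N (f : M -> N) : Prop :=
  smooth f /\ forall x (w : tangent N), exists v : tangent M, mdiff f x v = w.

(* The vector of T_xM, x = cinv c p, which has coordinates v in the chart c. *)
Definition chart_vector M (c : chart R (dim M) M) (p v : tangent M)
  : tangent M := 'd (cmap (chart_at (cinv c p)) \o cinv c) p v.

Record metric M := Metric {
  ip :> forall x : M, tangent M -> tangent M -> R;
  ip_linear : forall x a u v w, ip x (a *: u + v) w = a * ip x u w + ip x v w;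
  ip_sym : forall x u v, ip x u v = ip x v u;
  ip_pos : forall x u, u != 0 -> 0 < ip x u u;
  ip_smooth : forall (c : chart R (dim M) M) (v w : tangent M), atlas c ->
    smooth_on (cmap c @` cdom c)
      (fun p => ip (cinv c p) (chart_vector c p v) (chart_vector c p w) : R^o)
}.

Definition riemannian_submersion M N (eM : metric M) (eN : metric N)
    (f : M -> N) : Prop :=
  submersion f /\
  forall x (u v : tangent M),
    (forall w, mdiff f x w = 0 -> eM x u w = 0) ->
    (forall w, mdiff f x w = 0 -> eM x v w = 0) ->
    eN (f x) (mdiff f x u) (mdiff f x v) = eM x u v.

Definition transverse M N (eM : metric M) (f : M -> N) : Prop :=
  exists eN : metric N, riemannian_submersion eM eN f.

Definition preserves_metric M (e : metric M) (f : M -> M) : Prop :=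
  forall x (u v : tangent M), e (f x) (mdiff f x u) (mdiff f x v) = e x u v.

(* Smooth curves are parametrized by [0, 1], and smooth up to the end points in
   the sense that they extend to a neighborhood of [0, 1]. *)
Definition smooth_curve M (c : R -> M) : Prop :=
  exists2 U : set R, open U /\ `[0, 1] `<=` U &
    (forall a, U a -> {for a, continuous c}) /\
    forall k, atlas k ->
      smooth_on (U `&` c @^-1` cdom k : set R^o) (cmap k \o c).

Definition velocity M (c : R -> M) (a : R) : tangent M :=
  derive1 (cmap (chart_at (c a)) \o c) a.

Definition curve_length M (e : metric M) (c : R -> M) : \bar R :=
  (\int[lebesgue_measure]_(a in `[0%R, 1%R])
    (Num.sqrt (e (c a) (velocity c a) (velocity c a)))%:E)%E.

(* A piecewise smooth curve is a finite concatenation of smooth curves. *)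
Fixpoint piecewise_smooth M (x : M) (cs : seq (R -> M)) (y : M) : Prop :=
  match cs with
  | [::] => x = y
  | c :: cs' => [/\ c 0 = x, smooth_curve c & piecewise_smooth (c 1) cs' y]
  end.

Definition rdist M (e : metric M) (x y : M) : \bar R :=
  ereal_inf [set (\sum_(c <- cs) curve_length e c)%E
            | cs in [set cs | piecewise_smooth x cs y]].

End Manifolds.

(* arr2, with the projections pr1 and pr2, is the set G^(2) of the pairs
   (g, h) such that src g = tgt h, as an embedded submanifold of arr x arr;
   cpair is the pair (g, h) as an element of arr2. *)
Record lie_groupoid (R : realType) := LieGroupoid {
  obj : manifold R;
  arr : manifold R;
  obj_hausdorff : hausdorff_space obj;
  src : arr -> obj;
  tgt : arr -> obj;
  src_submersion : submersion src;
  tgt_submersion : submersion tgt;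
  src_surj : forall x, exists g, src g = x;
  tgt_surj : forall x, exists g, tgt g = x;
  arr2 : manifold R;
  pr1 : arr2 -> arr;
  pr2 : arr2 -> arr;
  composable : forall k, src (pr1 k) = tgt (pr2 k);
  cpair : forall g h, src g = tgt h -> arr2;
  cpair1 : forall g h (e : src g = tgt h), pr1 (cpair e) = g;
  cpair2 : forall g h (e : src g = tgt h), pr2 (cpair e) = h;
  comp_inj : forall k k', pr1 k = pr1 k' -> pr2 k = pr2 k' -> k = k';
  pr1_smooth : smooth pr1;
  pr2_smooth : smooth pr2;
  comp_immersed : forall k (v : tangent arr2),
    mdiff pr1 k v = 0 -> mdiff pr2 k v = 0 -> v = 0;
  comp_embedded : forall k (A : set arr2), nbhs k A ->
    exists B C, [/\ nbhs (pr1 k) B, nbhs (pr2 k) C &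
                    pr1 @^-1` B `&` pr2 @^-1` C `<=` A];
  gmult : arr2 -> arr;
  gunit : obj -> arr;
  ginv : arr -> arr;
  mult_smooth : smooth gmult;
  unit_smooth : smooth gunit;
  inv_smooth : smooth ginv;
  src_mult : forall k, src (gmult k) = src (pr2 k);
  tgt_mult : forall k, tgt (gmult k) = tgt (pr1 k);
  src_unit : forall x, src (gunit x) = x;
  tgt_unit : forall x, tgt (gunit x) = x;
  src_inv : forall g, src (ginv g) = tgt g;
  tgt_inv : forall g, tgt (ginv g) = src g;
  multA : forall f g h (fg : src f = tgt g) (gh : src g = tgt h)
      (fg_h : src (gmult (cpair fg)) = tgt h)
      (f_gh : src f = tgt (gmult (cpair gh))),
    gmult (cpair fg_h) = gmult (cpair f_gh);
  mult1g : forall g (e : src (gunit (tgt g)) = tgt g), gmult (cpair e) = g;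
  multg1 : forall g (e : src g = tgt (gunit (src g))), gmult (cpair e) = g;
  multVg : forall g (e : src (ginv g) = tgt g), gmult (cpair e) = gunit (src g);
  multgV : forall g (e : src g = tgt (ginv g)), gmult (cpair e) = gunit (tgt g)
}.
Arguments src {R} _ _.
Arguments tgt {R} _ _.
Arguments pr1 {R} _ _.
Arguments pr2 {R} _ _.
Arguments gmult {R} _ _.
Arguments gunit {R} _ _.
Arguments ginv {R} _ _.

Section Groupoids.
Context {R : realType}.
Implicit Types G : lie_groupoid R.

Lemma swap_composable G (k : arr2 G) :
  src G (ginv G (pr2 G k)) = tgt G (ginv G (pr1 G k)).
Proof. by rewrite src_inv tgt_inv composable. Qed.

Lemma turn_composable G (k : arr2 G) :
  src G (gmult G k) = tgt G (ginv G (pr2 G k)).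
Proof. by rewrite src_mult tgt_inv. Qed.

(* (g, h) |-> (h^-1, g^-1) and (g, h) |-> (gh, h^-1) generate the action of
   S_3 on G^(2). *)
Definition swap G (k : arr2 G) : arr2 G := cpair (swap_composable k).
Definition turn G (k : arr2 G) : arr2 G := cpair (turn_composable k).

Record groupoid_metric G := GroupoidMetric {
  gmetric :> metric (arr2 G);
  gmetric_swap : preserves_metric gmetric (@swap G);
  gmetric_turn : preserves_metric gmetric (@turn G);
  gmetric_transverse : transverse gmetric (gmult G)
}.

(* e1 and e0 are the metrics eta^(1) and eta^(0) induced by e. *)
Record induced_metrics G (e : groupoid_metric G)
    (e1 : metric (arr G)) (e0 : metric (obj G)) : Prop := InducedMetrics {
  induced_mult : riemannian_submersion e e1 (gmult G);
  induced_pr1 : riemannian_submersion e e1 (pr1 G);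
  induced_pr2 : riemannian_submersion e e1 (pr2 G);
  induced_src : riemannian_submersion e1 e0 (src G);
  induced_tgt : riemannian_submersion e1 e0 (tgt G)
}.

(* T_xO_x: the orbit of x is the image under tgt of the fiber of src over x,
   and tgt is a submersion from this fiber onto the orbit. *)
Definition orbit_tangent G (x : obj G) : set (tangent (obj G)) :=
  [set mdiff (tgt G) (gunit G x) w
  | w in [set w : tangent (arr G) | mdiff (src G) (gunit G x) w = 0]].

(* u is the image of the class of a under N_xO = T_xM/T_xO_x ~ (T_xO_x)^perp. *)
Definition normal_part G (e0 : metric (obj G)) (x : obj G)
    (a u : tangent (obj G)) : Prop :=
  orbit_tangent x (a - u) /\ forall w, orbit_tangent x w -> e0 x u w = 0.

(* r is the inner product of the classes of a and b in N_xO. *)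
Definition normal_ip G (e0 : metric (obj G)) (x : obj G)
    (a b : tangent (obj G)) (r : R) : Prop :=
  exists u v, [/\ normal_part e0 x a u, normal_part e0 x b v & e0 x u v = r].

Definition equivalent_metrics G (e0 e0' : metric (obj G)) : Prop :=
  forall x a b r, normal_ip e0 x a b r <-> normal_ip e0' x a b r.

Definition same_orbit G (x y : obj G) : Prop :=
  exists2 g, src G g = x & tgt G g = y.

Lemma same_orbit_refl G (x : obj G) : same_orbit x x.
Proof. by exists (gunit G x); rewrite ?src_unit ?tgt_unit. Qed.

Lemma same_orbit_sym G (x y : obj G) : same_orbit x y -> same_orbit y x.
Proof. by case=> g gx gy; exists (ginv G g); rewrite ?src_inv ?tgt_inv. Qed.

Lemma same_orbit_trans G (y x z : obj G) :
  same_orbit x y -> same_orbit y z -> same_orbit x z.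
Proof.
case=> g gx gy [h hy hz]; have e : src G h = tgt G g by rewrite gy.
by exists (gmult G (cpair e)); rewrite ?src_mult ?tgt_mult ?cpair1 ?cpair2.
Qed.

Definition same_orbitb G : rel (obj G) := fun x y => `[< same_orbit x y >].

Lemma same_orbitb_refl G : reflexive (@same_orbitb G).
Proof. by move=> x; apply/asboolP; exact: same_orbit_refl. Qed.

Lemma same_orbitb_sym G : symmetric (@same_orbitb G).
Proof. by move=> x y; apply/asboolP/asboolP; exact: same_orbit_sym. Qed.

Lemma same_orbitb_trans G : transitive (@same_orbitb G).
Proof.
move=> y x z /asboolP xy /asboolP yz; apply/asboolP.
exact: same_orbit_trans xy yz.
Qed.

Canonical same_orbit_equiv G : equiv_rel (obj G) :=
  EquivRel (@same_orbitb G) (@same_orbitb_refl G) (@same_orbitb_sym G)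
    (@same_orbitb_trans G).

Definition orbit_space G := {eq_quot (same_orbit_equiv G)}%qT.

Definition orbit_class G (x : obj G) : orbit_space G := (\pi x)%qT.

(* xs 0, ..., xs (2n + 1) is a chain from x to y. *)
Definition chain G (x y : obj G) (n : nat) (xs : nat -> obj G) : Prop :=
  [/\ xs 0%N = x, xs n.*2.+1 = y,
      forall i, (i <= n)%N -> same_orbit (xs i.*2) (xs i.*2.+1) &
      forall i, (0 < i <= n)%N ->
        connected_component setT (xs i.*2.-1) (xs i.*2)].

Definition chain_length G (e0 : metric (obj G)) (n : nat) (xs : nat -> obj G)
  : \bar R := (\sum_(1 <= i < n.+1) rdist e0 (xs i.*2.-1) (xs i.*2))%E.

Definition chain_inf G (e0 : metric (obj G)) (x y : obj G) : \bar R :=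
  ereal_inf [set l | exists n xs,
               chain x y n xs /\ l = chain_length e0 n xs].

Definition normal_dist G (e0 : metric (obj G)) (a b : orbit_space G) : \bar R :=
  chain_inf e0 (repr a) (repr b).

Lemma chain_inf_le G (e0 : metric (obj G)) (x x' y y' : obj G) :
  same_orbit x x' -> same_orbit y y' ->
  (chain_inf e0 x' y' <= chain_inf e0 x y)%E.
Proof.
move=> xx' yy'; apply: ereal_inf_le_tmp => _ [n [xs [[x0 yn orb con] ->]]].
pose ys i := if i == 0%N then x' else if i == n.*2.+1 then y' else xs i.
have ysE i : (0 < i < n.*2.+1)%N -> ys i = xs i.
  by case/andP; rewrite /ys lt0n => /negPf -> /ltn_eqF ->.
have ys_orb i : same_orbit (xs i) (ys i).
  rewrite /ys; have [-> | _] := eqVneq i 0%N; first by rewrite x0.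
  by have [-> | _] := eqVneq i n.*2.+1; rewrite ?yn //; exact: same_orbit_refl.
have odd_in i : (0 < i <= n)%N -> (0 < i.*2.-1 < n.*2.+1)%N.
  case: i => // i /andP[_ lt_in]; rewrite doubleS /= ltnS.
  by rewrite ltnW // -[(_ < _)%N]/((i.*2.+2 <= n.*2)%N) -doubleS leq_double.
have even_in i : (0 < i <= n)%N -> (0 < i.*2 < n.*2.+1)%N.
  by case/andP=> i0 lt_in; rewrite double_gt0 i0 ltnS leq_double.
exists n, ys; split; last first.
  rewrite /chain_length !big_nat; apply: eq_bigr => i i_n.
  by rewrite !ysE ?odd_in ?even_in.
split=> [|| i le_in | i i_n].
- by rewrite /ys eqxx.
- by rewrite /ys /= eqxx.
- apply: same_orbit_trans (same_orbit_sym (ys_orb _)) _.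
  exact: same_orbit_trans (orb i le_in) (ys_orb _).
- by rewrite !ysE ?odd_in ?even_in //; exact: con.
Qed.

(* d_N([x], [y]) does not depend on the representatives x and y. *)
Lemma normal_dist_class G (e0 : metric (obj G)) (x y : obj G) :
  normal_dist e0 (orbit_class x) (orbit_class y) = chain_inf e0 x y.
Proof.
have rep z : same_orbit (repr (@orbit_class G z)) z.
  apply/asboolP/(eqmodP (same_orbit_equiv G)).
  exact: (@reprK _ {eq_quot (same_orbit_equiv G)}%qT).
by apply/eqP; rewrite eq_le !chain_inf_le //; exact: same_orbit_sym.
Qed.

End Groupoids.

(* Main.v *)
From HB Require Import structures.
Require Import Defs.
From mathcomp Require Import all_boot all_order all_algebra.
From mathcomp Require Import all_classical all_reals all_analysis.
From mathcomp Require Import measurable_realfun zify ring lra.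
Import Defs.
Set Implicit Arguments.
Unset Strict Implicit.
Unset Printing Implicit Defensive.
Import Order.TTheory GRing.Theory Num.Theory.
Import numFieldNormedType.Exports.
Local Open Scope classical_set_scope.
Local Open Scope ring_scope.

(** An arrow moves a point along its orbit at no cost, so only the component of
    the motion normal to the orbits should be paid for, and the cost of this
    component is what equivalent metrics have in common.

    Fix equivalent metrics [e1], [e2] on the objects; by symmetry it is enough
    to bound the chain infimum of [e2] by that of [e1], and by the triangle
    inequality ([chain_inf_trans]) it is enough to bound the [e2]-chain infimum
    from [c 0] to [c 1] by the [e1]-length of a smooth curve [c]
    ([chain_inf_curve]).

    The infinitesimal version of this bound is the heart of the matter.  Let [v]
    be the velocity of [c] at the time [t].  By equivalence the class of [v]
    modulo the tangent space of the orbit has a representative [u] with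
    [e2 u u <= e1 v v] ([normal_part_le]).  As [v - u] is tangent to the orbit,
    some vector [W] tangent to the arrows at the unit of [c t] is mapped to [v]
    by [d src] and to [u] by [d tgt] ([orbit_slide]).  A path of arrows [g s]
    with velocity [W] then gives the chain

      c t,  tgt (g s) ~ src (g s),  c (t + s)

    in which the first move costs [s] times the [e2]-norm of [u], up to [o(s)],
    and the last one [o(s)] since both ends have velocity [v]
    ([chain_inf_slide]).

    To integrate this bound, the speed of [c] is shown to be continuous
    ([speed_continuous]), and intervals on which the cost is at most the
    integral of the speed plus a small multiple of their length are chained by
    a supremum argument ([interval_chaining]). *)

(** * Calculus of [Ck_on] maps *)

Section CkCalculus.
Context {R : realType}.

(** Differentials are germs: the chain rule below is applied to compositions of
    charts which agree with the intended map only near the base point. *)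
Lemma near_eq_differentiable (V W : normedModType R) (f g : V -> W) x :
  (\forall y \near x, f y = g y) -> differentiable f x ->
  differentiable g x /\ 'd g x = 'd f x :> (V -> W).
Proof.
move=> fg /diff_locallyP[cdf f_o].
have fgx : f x = g x by exact: nbhs_singleton fg.
have g_o : g \o shift x = cst (g x) + 'd f x +o_ 0 id.
  apply/eqaddoP => _/posnumP[e].
  have fg0 : \forall h \near (0 : V), f (h + x) = g (h + x).
    move: fg; rewrite (near_shift 0 x).
    by apply: filterS => h /=; rewrite subr0.
  move/eqaddoP: f_o => /(_ e%:num (gt0 e)) f_o.
  by apply: filterS2 fg0 f_o => h /= fgh; rewrite !fctE/= fgx fgh.
have dgf := diff_unique cdf g_o.
split; last exact: dgf.
by apply/diff_locallyP; rewrite dgf; split; [exact: cdf | exact: g_o].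
Unshelve. all: by end_near.
Qed.

Lemma diff_comp_apply (U V W : normedModType R) (f : U -> V) (g : V -> W) x v :
  differentiable f x -> differentiable g (f x) ->
  'd (g \o f) x v = 'd g (f x) ('d f x v).
Proof. by move=> df dg; rewrite (diff_comp df dg). Qed.

Lemma Ck_on_sub (V W : normedModType R) k (U U' : set V) (f : V -> W) :
  U' `<=` U -> Ck_on k U f -> Ck_on k U' f.
Proof.
elim: k f => [|k IH] f sub /=; first by move=> Cf x /sub; exact: Cf.
by case=> df Df; split=> [x /sub /df // | v]; exact: IH.
Qed.

Lemma eq_Ck_on (V W : normedModType R) k (U : set V) (f g : V -> W) :
  open U -> (forall x, U x -> f x = g x) -> Ck_on k U f -> Ck_on k U g.
Proof.
move=> oU; elim: k f g => [|k IH] f g fg /=.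
  move=> Cf x Ux; have fgx : \forall y \near x, f y = g y.
    by near=> y; apply: fg; near: y; exact: open_nbhs_nbhs.
  rewrite /prop_for/= /continuous_at -(fg x)//; apply: cvg_trans (Cf x Ux).
  exact: near_eq_cvg.
have near_fg x : U x -> \forall y \near x, f y = g y.
  by move=> Ux; near=> y; apply: fg; near: y; exact: open_nbhs_nbhs.
case=> df Df; split=> [x Ux | v].
  by have [] := near_eq_differentiable (near_fg x Ux) (df x Ux).
apply: IH (Df v) => x Ux; apply: near_eq_derive; exact: near_fg.
Unshelve. all: by end_near.
Qed.

Lemma smooth_on_cont (V W : normedModType R) (U : set V) (f : V -> W) x :
  smooth_on U f -> U x -> {for x, continuous f}.
Proof. by move=> /(_ 0%N); exact. Qed.

Lemma smooth_on_diff (V W : normedModType R) (U : set V) (f : V -> W) x :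
  smooth_on U f -> U x -> differentiable f x.
Proof. by move=> /(_ 1%N)[df _]; exact: df. Qed.

Lemma smooth_on_derive_cont (V W : normedModType R) (U : set V) (f : V -> W)
    x v :
  smooth_on U f -> U x -> {for x, continuous ('D_v f)}.
Proof. by move=> /(_ 1%N)[_ /(_ v) Df]; exact: Df. Qed.

Definition line (V : normedModType R) (p w : V) (a : R^o) : V := p + a *: w.

Lemma line_diff (V : normedModType R) (p w : V) (a : R^o) :
  differentiable (line p w) a /\ forall h, 'd (line p w) a h = h *: w.
Proof.
have lin : linear (fun h : R^o => h *: w).
  by move=> k x y; rewrite scalerDl scalerA.
pose L : {linear R^o -> V} := HB.pack (fun h : R^o => h *: w)
  (GRing.isLinear.Build _ _ _ _ _ lin).
have cL : continuous L by exact: scalel_continuous.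
have dL : differentiable L a by exact: linear_differentiable.
have -> : line p w = cst p + L by [].
split; first exact: differentiableD.
by move=> h; rewrite diffD// diff_cst diff_lin//; exact: add0r.
Qed.

Lemma line_cont (V : normedModType R) (p w : V) : continuous (line p w).
Proof.
by move=> a; apply: differentiable_continuous; exact: (line_diff p w a).1.
Qed.

(** The directional derivative along [h] of [f \o line p w] is the one of [f]
    along [h *: w], which stays of the form handled by the induction. *)
Lemma Ck_on_line (V W : normedModType R) k (U : set V) (f : V -> W) p w :
  open U -> Ck_on k U f -> Ck_on k (line p w @^-1` U) (f \o line p w).
Proof.
move=> oU; elim: k f => [|k IH] f /=.
  move=> Cf a Ua; apply: continuous_comp; first exact: line_cont.
  exact: Cf.
case=> df Df; split=> [a Ua | h].
  by apply: differentiable_comp; [exact: (line_diff p w a).1 | exact: df].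
apply: eq_Ck_on (IH _ (Df (h *: w))).
  by apply: open_comp => // ? _; exact: line_cont.
move=> a /= Ua; have [dl dlE] := line_diff p w a.
have dfa := df _ Ua.
rewrite (deriveE _ dfa) (deriveE _ (differentiable_comp dl dfa)).
by rewrite (diff_comp dl dfa) -dlE.
Qed.

Lemma smooth_on_line (V W : normedModType R) (U : set V) (f : V -> W) p w :
  open U -> smooth_on U f -> smooth_on (line p w @^-1` U) (f \o line p w).
Proof. by move=> oU sf k; exact: Ck_on_line. Qed.

End CkCalculus.

(** * Charts, differentials and metrics in coordinates *)

Section Charts.
Context {R : realType}.
Implicit Types M N P : manifold R.

Lemma chart_image_open M (c : chart R (dim M) M) (A : set M) :
  open A -> open (cmap c @` (cdom c `&` A)).
Proof.
move=> oA; rewrite openE => _ [x [cx Ax] <-].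
have img : (cmap c @` cdom c) (cmap c x) by exists x.
have near_img := open_nbhs_nbhs (conj (@cimg_open _ _ _ c) img).
have near_A : \forall u \near cmap c x, A (cinv c u).
  by apply: (cinv_cont img); rewrite cmapK//; exact: open_nbhs_nbhs.
apply: filterS2 near_img near_A => _ [y cy <-].
by rewrite cmapK// => Ay; exists y.
Qed.

Lemma near_cdom M (c : chart R (dim M) M) x : cdom c x ->
  \forall y \near x, cdom c y.
Proof. by move=> cx; apply: open_nbhs_nbhs; split=> //; exact: cdom_open. Qed.

Lemma near_cinv M (c : chart R (dim M) M) (A : set M) x :
  cdom c x -> nbhs x A ->
  \forall u \near cmap c x, A (cinv c u).
Proof.
move=> cx xA; have img : (cmap c @` cdom c) (cmap c x) by exists x.
by apply: (cinv_cont img); rewrite cmapK.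
Qed.

Lemma near_cinvK M (c : chart R (dim M) M) x : cdom c x ->
  \forall u \near cmap c x, cmap c (cinv c u) = u.
Proof.
move=> cx; have img : (cmap c @` cdom c) (cmap c x) by exists x.
have near_img := open_nbhs_nbhs (conj (@cimg_open _ _ _ c) img).
by apply: filterS near_img => _ [y cy <-]; rewrite cmapK.
Qed.

Lemma transition_diff M (c c' : chart R (dim M) M) x :
  atlas c -> atlas c' -> cdom c x -> cdom c' x ->
  differentiable (cmap c' \o cinv c) (cmap c x).
Proof.
move=> ac ac' cx c'x.
by apply: smooth_on_diff (atlas_compat ac ac') _; exists x.
Qed.

Lemma smooth_diff M N (f : M -> N) (c : chart R (dim M) M)
    (c' : chart R (dim N) N) x :
  smooth f -> atlas c -> atlas c' -> cdom c x -> cdom c' (f x) ->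
  differentiable (cmap c' \o f \o cinv c) (cmap c x).
Proof.
move=> [_ sf] ac ac' cx c'x.
by apply: smooth_on_diff (sf _ _ ac ac') _; exists x.
Qed.

Lemma chart_at_diff M N (f : M -> N) x : smooth f ->
  differentiable (cmap (chart_at (f x)) \o f \o cinv (chart_at x))
    (cmap (chart_at x) x).
Proof.
by move=> sf; apply: smooth_diff => //;
  [exact: chart_at_atlas..| |]; exact: chart_at_dom.
Qed.

Lemma mdiff_id M (x : M) (v : tangent M) : mdiff id x v = v.
Proof.
have E : \forall u \near cmap (chart_at x) x,
    id u = (cmap (chart_at x) \o id \o cinv (chart_at x)) u.
  by apply: filterS (near_cinvK (chart_at_dom x)) => u /= ->.
have [did didE] : is_diff (cmap (chart_at x) x) id id by exact: is_diff_id.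
have [_ dE] := near_eq_differentiable E did.
by rewrite /mdiff dE didE.
Qed.

Lemma mdiff_comp M N P (f : M -> N) (g : N -> P) x (v : tangent M) :
  smooth f -> smooth g -> mdiff (g \o f) x v = mdiff g (f x) (mdiff f x v).
Proof.
move=> sf sg; have df := chart_at_diff x sf; have dg := chart_at_diff (f x) sg.
pose F := cmap (chart_at (f x)) \o f \o cinv (chart_at x).
pose H := cmap (chart_at (g (f x))) \o g \o cinv (chart_at (f x)).
have FE : F (cmap (chart_at x) x) = cmap (chart_at (f x)) (f x).
  by rewrite /F /= cmapK//; exact: chart_at_dom.
rewrite -FE in dg.
have E : \forall u \near cmap (chart_at x) x,
    (H \o F) u = (cmap (chart_at (g (f x))) \o (g \o f) \o cinv (chart_at x)) u.
  have fcont : \forall y \near x, cdom (chart_at (f x)) (f y).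
    apply: sf.1; exact: near_cdom (chart_at_dom _).
  have := near_cinv (chart_at_dom x) fcont.
  by apply: filterS => u /= fu; rewrite /H/F/= cmapK.
have [_ dE] := near_eq_differentiable E (differentiable_comp df dg).
by rewrite /mdiff dE (diff_comp df dg) -FE.
Qed.

Lemma chart_vector_own M (x : M) (v : tangent M) :
  chart_vector (chart_at x) (cmap (chart_at x) x) v = v.
Proof.
rewrite -[RHS](mdiff_id x v) /chart_vector /mdiff cmapK//; exact: chart_at_dom.
Qed.

(** Velocities are expressed in the preferred chart of the moving point [c a],
    which jumps with [a]; a fixed chart [k] makes them continuous in [a]. *)
Lemma velocity_chart M (k : chart R (dim M) M) (c : R -> M) (a : R) :
  atlas k -> cdom k (c a) -> {for a, continuous c} ->
  differentiable (cmap k \o c : R^o -> _) a ->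
  velocity c a = chart_vector k (cmap k (c a)) (derive1 (cmap k \o c) a).
Proof.
move=> ak ka cc dk; rewrite /velocity /chart_vector cmapK//.
have dT : differentiable (cmap (chart_at (c a)) \o cinv k) ((cmap k \o c) a).
  by apply: transition_diff => //; [exact: chart_at_atlas|exact: chart_at_dom].
have E : \forall b \near (a : R^o),
    ((cmap (chart_at (c a)) \o cinv k) \o (cmap k \o c)) b =
    (cmap (chart_at (c a)) \o c) b.
  have kc : \forall b \near a, cdom k (c b) by apply: cc; exact: near_cdom.
  by apply: filterS kc => b /= kb; rewrite cmapK.
rewrite !derive1E -(near_eq_derive (1 : R^o) E).
rewrite (deriveE _ (differentiable_comp dk dT)) (deriveE _ dk).
exact: (diff_comp_apply _ dk dT).
Qed.

Lemma smooth_curve_chart M (c : R -> M) (k : chart R (dim M) M) (a : R) :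
  smooth_curve c -> `[0, 1]%classic a -> atlas k -> cdom k (c a) ->
  {for a, continuous (derive1 (cmap k \o c))} /\
  \forall b \near a, [/\ cdom k (c b), {for b, continuous c} &
    differentiable (cmap k \o c : R^o -> _) b].
Proof.
case=> U [oU U01] [cc sc] /U01 Ua ak ka; split.
  have cD := @smooth_on_derive_cont R R^o _ _ _ a (1 : R^o) (sc k ak)
    (conj Ua ka).
  have -> : derive1 (cmap k \o c) = 'D_(1 : R^o) (cmap k \o c).
    by apply/funext => b; exact: derive1E.
  exact: cD.
have Unear : \forall b \near a, U b by exact: open_nbhs_nbhs.
have knear : \forall b \near a, cdom k (c b).
  by apply: cc => //; exact: near_cdom.
apply: filterS2 Unear knear => b Ub kb; split=> //; first exact: cc.
by apply: smooth_on_diff (sc k ak) _.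
Qed.

Lemma cvg_sumr (T I : Type) (F : set_system T) (FF : Filter F) (r : seq I)
    (f : I -> T -> R) (l : I -> R) :
  (forall i, f i t @[t --> F] --> l i) ->
  (\sum_(i <- r) f i t) @[t --> F] --> \sum_(i <- r) l i.
Proof.
move=> fl; elim: r => [|i r IH].
  by rewrite big_nil; under eq_fun do rewrite big_nil; exact: cvg_cst.
by rewrite big_cons; under eq_fun do rewrite big_cons; exact: cvgD.
Qed.

Lemma ip0 M (e : metric M) x w : e x 0 w = 0.
Proof.
have := ip_linear e x 1 0 0 w; rewrite scale1r addr0 mul1r -[LHS]addr0.
by move/addrI.
Qed.

Lemma ipZ M (e : metric M) x a u w : e x (a *: u) w = a * e x u w.
Proof. by have := ip_linear e x a u 0 w; rewrite addr0 ip0 addr0. Qed.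

Lemma ipZr M (e : metric M) x a u w : e x w (a *: u) = a * e x w u.
Proof. by rewrite ip_sym ipZ ip_sym. Qed.

Lemma ipD M (e : metric M) x u v w : e x (u + v) w = e x u w + e x v w.
Proof. by have := ip_linear e x 1 u v w; rewrite scale1r mul1r. Qed.

Lemma ip_suml M (e : metric M) x (I : Type) (r : seq I) f w :
  e x (\sum_(i <- r) f i) w = \sum_(i <- r) e x (f i) w.
Proof.
by elim: r => [|i r IH]; rewrite ?big_nil ?ip0// !big_cons ipD IH.
Qed.

Lemma ip_ge0 M (e : metric M) x u : 0 <= e x u u.
Proof. by have [->|u0] := eqVneq u 0; [rewrite ip0|exact/ltW/ip_pos]. Qed.

(** The inner products of a fixed tangent space are read in the coordinates of a
    chart [k] around it, where base point and vectors vary independently. *)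
Definition chart_ip M (e : metric M) (k : chart R (dim M) M)
    (p v w : tangent M) :=
  e (cinv k p) (chart_vector k p v) (chart_vector k p w).

Lemma chart_ipZ M (e : metric M) (k : chart R (dim M) M) (p w : tangent M) a :
  chart_ip e k p (a *: w) (a *: w) = a ^+ 2 * chart_ip e k p w w.
Proof.
have cvZ : chart_vector k p (a *: w) = a *: chart_vector k p w.
  exact: linearZ.
by rewrite /chart_ip cvZ ipZ ipZr mulrA expr2.
Qed.

Lemma chart_ip_sum M (e : metric M) (k : chart R (dim M) M) (p w : tangent M) :
  chart_ip e k p w w = \sum_i \sum_j
    w 0 i * (w 0 j * chart_ip e k p (delta_mx 0 i) (delta_mx 0 j)).
Proof.
have cvE : chart_vector k p w = \sum_i w 0 i *: chart_vector k p (delta_mx 0 i).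
  rewrite {1}(row_sum_delta w) /chart_vector linear_sum.
  by apply: eq_bigr => i _; rewrite linearZ.
rewrite /chart_ip {1}cvE ip_suml; apply: eq_bigr => i _.
rewrite ipZ -mulr_sumr; congr (_ * _).
rewrite cvE ip_sym ip_suml; apply: eq_bigr => j _.
by rewrite ipZ ip_sym.
Qed.

(** Smoothness of the metric only gives continuity in the base point for fixed
    vectors; expanding in the standard basis makes it joint. *)
Lemma chart_ip_cvg M (e : metric M) (k : chart R (dim M) M) (x : M)
    (T : Type) (F : set_system T) (FF : Filter F) (p w : T -> tangent M)
    (w0 : tangent M) :
  atlas k -> cdom k x ->
  p t @[t --> F] --> cmap k x -> w t @[t --> F] --> w0 ->
  chart_ip e k (p t) (w t) (w t) @[t --> F] --> chart_ip e k (cmap k x) w0 w0.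
Proof.
move=> ak kx px ww; rewrite chart_ip_sum; under eq_fun do rewrite chart_ip_sum.
have cw i : w t 0 i @[t --> F] --> w0 0 i.
  exact: (cvg_comp _ _ ww (@coord_continuous R 1 _ 0 i w0)).
have cip i j : chart_ip e k (p t) (delta_mx 0 i) (delta_mx 0 j)
    @[t --> F] -->
    chart_ip e k (cmap k x) (delta_mx 0 i) (delta_mx 0 j).
  have sm := @ip_smooth _ _ e k (delta_mx 0 i) (delta_mx 0 j) ak.
  have kx' : (cmap k @` cdom k) (cmap k x) by exists x.
  exact: (cvg_comp _ _ px (smooth_on_cont sm kx')).
apply: cvg_sumr => i; apply: cvg_sumr => j.
by apply: cvgM; [exact: cw|apply: cvgM; [exact: cw|exact: cip]].
Qed.

End Charts.

(** * Lengths and distances *)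

Section Lengths.
Context {R : realType}.
Implicit Types M : manifold R.

Definition speed M (e : metric M) (c : R -> M) (a : R) : R :=
  Num.sqrt (e (c a) (velocity c a) (velocity c a)).

Lemma speed_continuous M (e : metric M) (c : R -> M) (a : R) :
  smooth_curve c -> `[0, 1]%classic a -> {for a, continuous (speed e c)}.
Proof.
move=> sc a01; pose k := chart_at (c a).
have ak : atlas k by exact: chart_at_atlas.
have ka : cdom k (c a) by exact: chart_at_dom.
have [cD near_k] := smooth_curve_chart sc a01 ak ka.
pose D := derive1 (cmap k \o c).
have spE b : [/\ cdom k (c b), {for b, continuous c} &
    differentiable (cmap k \o c : R^o -> _) b] ->
    speed e c b = Num.sqrt (chart_ip e k (cmap k (c b)) (D b) (D b)).
  case=> kb cb db.
  by rewrite /speed /chart_ip cmapK// (velocity_chart ak kb cb db).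
rewrite /prop_for /continuous_at (spE a (nbhs_singleton near_k)).
have E : \forall b \near a,
    Num.sqrt (chart_ip e k (cmap k (c b)) (D b) (D b)) = speed e c b.
  by apply: filterS near_k => b /spE.
apply: cvg_trans (near_eq_cvg E) _.
apply: (@cvg_comp _ _ _ (fun b => chart_ip e k (cmap k (c b)) (D b) (D b))
  Num.sqrt); last exact: sqrt_continuous.
apply: chart_ip_cvg => //.
by have [_ _ /differentiable_continuous] := nbhs_singleton near_k.
Qed.

Lemma speed_measurable M (e : metric M) (c : R -> M) (A : set R) :
  smooth_curve c -> measurable A -> A `<=` `[0, 1]%classic ->
  measurable_fun A (speed e c).
Proof.
move=> sc mA A01.
apply: measurable_funS A01 _; first exact: measurable_itv.
apply: subspace_continuous_measurable_fun; first exact: measurable_itv.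
by apply: continuous_in_subspaceT => a; rewrite inE; exact: speed_continuous.
Qed.

Lemma curve_length_le M (e : metric M) (c : R -> M) (r : R) :
  smooth_curve c -> (forall a, `[0, 1]%classic a -> speed e c a <= r) ->
  (curve_length e c <= r%:E)%E.
Proof.
move=> sc spr; rewrite /curve_length.
have -> : r%:E = (\int[lebesgue_measure]_(a in `[0%R, 1%R]) (cst r%:E a))%E.
  rewrite integral_cst//= lebesgue_measure_itv/= lte_fin ltr01.
  by rewrite oppr0 adde0 mule1.
apply: ge0_le_integral => //.
by apply/measurable_EFinP; exact: (speed_measurable e sc).
Qed.

Lemma curve_length_ge0 M (e : metric M) (c : R -> M) :
  (0 <= curve_length e c)%E.
Proof. by apply: integral_ge0 => a _; rewrite lee_fin sqrtr_ge0. Qed.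

Lemma rdist_ge0 M (e : metric M) (x y : M) : (0 <= rdist e x y)%E.
Proof.
apply: le_ereal_inf_tmp => _ [cs _ <-]; apply: sume_ge0 => c _.
exact: curve_length_ge0.
Qed.

Section Segment.
Context (M : manifold R) (k : chart R (dim M) M) (p w : 'rV[R]_(dim M)).
Context (ak : atlas k)
  (seg : forall a : R, `[0, 1]%classic a -> (cmap k @` cdom k) (line p w a)).
Let c := cinv k \o line p w.
Let U := line p w @^-1` (cmap k @` cdom k).

Let line_open (A : set (tangent M)) : open A -> open (line p w @^-1` A).
Proof. by move=> oA; apply: open_comp => // ? _; exact: line_cont. Qed.

Let c_cont a : U a -> {for a, continuous c}.
Proof.
move=> Ua; apply: continuous_comp; first exact: line_cont.
exact: cinv_cont.
Qed.

Lemma segment_smooth : smooth_curve c.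
Proof.
exists U; first by split=> //; apply: line_open; exact: cimg_open.
split=> [a /c_cont // | k' ak'].
have := smooth_on_line p w (@chart_image_open _ _ k _ (@cdom_open _ _ _ k'))
  (atlas_compat ak ak').
move=> + j => /(_ j); apply: Ck_on_sub => a [[x kx xa]].
by rewrite /c /= -xa cmapK// => k'x; exists x.
Qed.

Lemma segment_velocity a : `[0, 1]%classic a ->
  velocity c a = chart_vector k (line p w a) w.
Proof.
move=> /seg Ua.
have E : \forall b \near (a : R^o), line p w b = (cmap k \o c) b.
  have near_U : \forall b \near (a : R^o), U b.
    by apply: open_nbhs_nbhs; split=> //; apply: line_open; exact: cimg_open.
  by apply: filterS near_U => b [x kx xb]; rewrite /c/= -xb cmapK.
have [dl dlE] := line_diff p w a.
have [dk _] := near_eq_differentiable E dl.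
have kc : cdom k (c a) by rewrite /c/=; case: Ua => x kx <-; rewrite cmapK.
rewrite (velocity_chart ak kc (c_cont Ua) dk).
rewrite -[cmap k (c a)](nbhs_singleton E) derive1E -(near_eq_derive (1:R^o) E).
by rewrite (deriveE _ dl) dlE scale1r.
Qed.

Lemma segment_rdist (e : metric M) (r : R) :
  (forall a : R, `[0, 1]%classic a ->
    Num.sqrt (chart_ip e k (line p w a) w w) <= r) ->
  (rdist e (cinv k p) (cinv k (p + w)) <= r%:E)%E.
Proof.
move=> spr; apply: le_trans (_ : (curve_length e c <= _)%E).
  apply: ereal_inf_lbound; exists [:: c]; last by rewrite big_seq1.
  split; rewrite /c/line/= ?scale0r ?addr0 ?scale1r//; exact: segment_smooth.
apply: curve_length_le; first exact: segment_smooth.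
by move=> a a01; rewrite /speed segment_velocity//; exact: spr.
Qed.

End Segment.

Lemma dnbhs0_id : s @[s --> (0 : R)^'] --> (0 : R).
Proof. by apply: cvg_within_filter; exact: cvg_id. Qed.

(** The distance is compared with the length of the segment that is straight in
    the chart [k].  This length is at most the largest norm of
    [(q s - p s) / s] along the segment, times [`|s|]; by joint continuity of
    the metric these norms tend to the norm of [w0] at [x]. *)
Lemma rdist_near M (e : metric M) (k : chart R (dim M) M) (x : M)
    (p q : R -> tangent M) (w0 : tangent M) (r : R) :
  atlas k -> cdom k x ->
  p s @[s --> 0^'] --> cmap k x ->
  s^-1 *: (q s - p s) @[s --> 0^'] --> w0 ->
  Num.sqrt (chart_ip e k (cmap k x) w0 w0) < r ->
  \forall s \near 0^',
    (rdist e (cinv k (p s)) (cinv k (q s)) <= (`|s| * r)%:E)%E.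
Proof.
move=> ak kx px wx lt_r; set p0 := cmap k x in px lt_r *.
have sp_cvg : Num.sqrt (chart_ip e k u.1 u.2 u.2)
    @[u --> filter_prod (nbhs p0) (nbhs w0)]
    --> Num.sqrt (chart_ip e k p0 w0 w0).
  have ip_cvg : chart_ip e k u.1 u.2 u.2
      @[u --> filter_prod (nbhs p0) (nbhs w0)]
      --> chart_ip e k p0 w0 w0.
    by apply: chart_ip_cvg => //; [exact: cvg_fst|exact: cvg_snd].
  exact: (cvg_comp _ _ ip_cvg (@sqrt_continuous R _)).
have [[A B] /= [p0A w0B] ABr] := cvgr_lt _ sp_cvg _ lt_r.
have img : nbhs p0 (cmap k @` cdom k).
  by apply: open_nbhs_nbhs; split; [exact: cimg_open|exists x].
(* a ball in place of the neighborhood [A], so that it contains the segment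
   between [p s] and [q s] *)
have /nbhs_ballP[d /= d0 dA] : nbhs p0 (A `&` (cmap k @` cdom k)).
  exact: filterI.
have qx : q s @[s --> 0^'] --> p0.
  have : p s + s *: (s^-1 *: (q s - p s)) @[s --> 0^'] --> p0 + (0 : R) *: w0.
    by apply: cvgD px _; apply: cvgZ wx; exact: dnbhs0_id.
  rewrite scale0r addr0; apply: cvg_trans; apply: near_eq_cvg.
  near=> s; have s0 : s != 0 by near: s; exact: nbhs_dnbhs_neq.
  by rewrite scalerA divff// scale1r addrC subrK.
near=> s.
have s0 : s != 0 by near: s; exact: nbhs_dnbhs_neq.
have ps : `|p0 - p s| < d by near: s; exact: cvgr_dist_lt.
have qs : `|p0 - q s| < d by near: s; exact: cvgr_dist_lt.
have ws : B (s^-1 *: (q s - p s)) by near: s; exact: wx.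
rewrite -[q s](subrK (p s)) addrC.
have in_ball a : `[0, 1]%classic a -> ball p0 d (line (p s) (q s - p s) a).
  rewrite /= in_itv/= => /andP[a0 a1]; rewrite -ball_normE/=.
  have -> : p0 - line (p s) (q s - p s) a =
      (1 - a) *: (p0 - p s) + a *: (p0 - q s).
    rewrite /line; apply/rowP => j; rewrite !mxE; ring.
  have a1' : 0 <= 1 - a by rewrite subr_ge0.
  apply: le_lt_trans (ler_normD _ _) _; rewrite !normrZ !ger0_norm//.
  have [a_lt1|] := ltP a 1.
    have : (1 - a) * `|p0 - p s| < (1 - a) * d by rewrite ltr_pM2l ?subr_gt0.
    have : a * `|p0 - q s| <= a * d by rewrite ler_wpM2l// ltW.
    lra.
  move=> a_ge1; have -> : a = 1 by lra.
  by rewrite subrr mul0r add0r mul1r.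
apply: segment_rdist => //.
  by move=> a /in_ball/dA[].
move=> a /in_ball/dA[Aa _].
have wE : q s - p s = s *: (s^-1 *: (q s - p s)).
  by rewrite scalerA divff ?scale1r.
set u := line _ _ _ in Aa *; rewrite wE chart_ipZ.
rewrite sqrtrM ?sqr_ge0// sqrtr_sqr ler_wpM2l//; apply: ltW.
exact: (ABr (_, _)).
Unshelve. all: by end_near.
Qed.

End Lengths.

(** * The infimum over chains *)

Section NormalDistance.
Context {R : realType}.

Lemma piecewise_smooth_connected (M : manifold R) (x y : M) cs :
  piecewise_smooth x cs y -> connected_component setT x y.
Proof.
elim: cs x => [|c cs IH] x /=; first by move->; exact: connected_component_refl.
case=> <- sc /IH; apply: connected_component_trans.
exists (c @` `[0, 1]); last by exists 1 => //=; rewrite in_itv/= lexx ler01.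
split=> //; first by exists 0 => //=; rewrite in_itv/= lexx ler01.
apply: connected_continuous_connected; first exact: segment_connected.
case: sc => U [_ U01] [cc _]; apply: continuous_in_subspaceT => a.
by rewrite inE => /U01; exact: cc.
Qed.

Context (G : lie_groupoid R) (e : metric (obj G)).

Lemma chain_length_ge0 n xs : (0 <= chain_length e n xs)%E.
Proof. by apply: sume_ge0 => i _; exact: rdist_ge0. Qed.

Lemma chain_inf_ge0 x y : (0 <= chain_inf e x y)%E.
Proof.
by apply: le_ereal_inf_tmp => _ [n [xs [_ ->]]]; exact: chain_length_ge0.
Qed.

Lemma chain_inf_orbit x y : same_orbit x y -> (chain_inf e x y <= 0)%E.
Proof.
move=> xy; apply: ereal_inf_lbound.
exists 0%N, (fun i => if i == 0%N then x else y).
split; last by rewrite /chain_length big_geq.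
by split=> //= -[|i]//=; rewrite ltn0.
Qed.

(** If no curve joins [x] to [y] the distance is infinite; otherwise a curve
    shows that they lie in one component, so that [x, x, y, y] is a chain. *)
Lemma chain_inf_rdist x y : (chain_inf e x y <= rdist e x y)%E.
Proof.
apply: le_ereal_inf_tmp => _ [cs /= xy <-].
apply: (@le_trans _ _ (rdist e x y)); last first.
  by apply: ereal_inf_lbound; exists cs.
apply: ereal_inf_lbound; exists 1%N, (fun i => if (i <= 1)%N then x else y).
split; last by rewrite /chain_length big_nat1.
split=> //= [[|[|i]]//= _|[|[|i]]//= _]; [exact: same_orbit_refl..|].
exact: piecewise_smooth_connected xy.
Qed.

(** Two chains are concatenated by merging the last orbit jump of the first with
    the first orbit jump of the second, which costs nothing. *)
Lemma chain_inf_trans x y z :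
  (chain_inf e x z <= chain_inf e x y + chain_inf e y z)%E.
Proof.
have cat n xs m ys : chain x y n xs -> chain y z m ys ->
    (chain_inf e x z <= chain_length e n xs + chain_length e m ys)%E.
  move=> [xs0 xsn xo xc] [ys0 ysm yo yc].
  have [zs zsl zsr] : exists2 zs, forall i, (i <= n.*2)%N -> zs i = xs i &
      forall i, (0 < i)%N -> zs (n.*2 + i)%N = ys i.
    exists (fun i => if (i <= n.*2)%N then xs i else ys (i - n.*2)%N) =>
      [i -> //|i i0].
    by rewrite ifF ?addKn//; lia.
  apply: ereal_inf_lbound; exists (n + m)%N, zs; split.
    split.
    - by rewrite zsl.
    - by rewrite doubleD -addnS zsr.
    - move=> i le_i; have [lt_in|lt_ni|->] := ltngtP i n.
      + by rewrite (zsl i.*2) ?(zsl i.*2.+1); [apply: xo|..]; lia.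
      + have [j jm ->] : exists2 j, (0 < j <= m)%N & i = (n + j)%N.
          by exists (i - n)%N; lia.
        by rewrite doubleD -addnS !zsr; [apply: yo|..]; lia.
      + rewrite -[n.*2.+1]addn1 zsr// zsl//.
        apply: (same_orbit_trans (xo n (leqnn _))); rewrite xsn -ys0.
        exact: (yo 0%N).
    - move=> i /andP[i0 le_i]; have [le_in|lt_ni] := leqP i n.
        by rewrite (zsl i.*2) ?(zsl i.*2.-1); [apply: xc|..]; lia.
      have [j jm ->] : exists2 j, (j.+1 <= m)%N & i = (n + j.+1)%N.
        by exists (i - n).-1; lia.
      have -> : (n + j.+1).*2.-1 = (n.*2 + j.+1.*2.-1)%N by lia.
      by rewrite doubleD !zsr; [apply: yc|..]; lia.
  rewrite [RHS]/chain_length (@big_cat_nat _ _ _ n.+1)//; last by lia.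
  congr (_ + _)%E.
    by apply: eq_big_nat => i i_n; rewrite (zsl i.*2) ?(zsl i.*2.-1)//; lia.
  rewrite /chain_length [LHS]big_add1 [RHS]big_add1 !succnK.
  rewrite -{1}[n]add0n big_addn addKn.
  apply: eq_big_nat => i _.
  have -> : (i + n).+1.*2 = (n.*2 + i.+1.*2)%N by lia.
  have -> : (n.*2 + i.+1.*2).-1 = (n.*2 + i.+1.*2.-1)%N by lia.
  by rewrite !zsr//; lia.
have [|fx] := eqVneq (chain_inf e x y) +oo%E.
  move=> ->; rewrite addye ?leey// gt_eqF//.
  exact: lt_le_trans (ltNyr 0) (chain_inf_ge0 _ _).
have [|fy] := eqVneq (chain_inf e y z) +oo%E.
  move=> ->; rewrite addey ?leey// gt_eqF//.
  exact: lt_le_trans (ltNyr 0) (chain_inf_ge0 _ _).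
have fin a b : chain_inf e a b != +oo%E -> chain_inf e a b \is a fin_num.
  by move=> ab; rewrite ge0_fin_numE ?chain_inf_ge0// ltey.
apply/lee_addgt0Pr => d d0; have d2 : 0 < d / 2 by rewrite divr_gt0.
have [_ [n [xs [ch1 ->]]] lt1] := lb_ereal_inf_adherent d2 (fin _ _ fx).
have [_ [m [ys [ch2 ->]]] lt2] := lb_ereal_inf_adherent d2 (fin _ _ fy).
apply: le_trans (cat _ _ _ _ ch1 ch2) _; rewrite [d]splitr EFinD addeACA.
by apply: leeD; exact: ltW.
Qed.

End NormalDistance.

(** * Paths to first order *)

Section TangentPaths.
Context {R : realType}.
Implicit Types M N : manifold R.

(** [p s = x + s v + o(s)] as [s] tends to 0 with either sign. *)
Definition tangent_path M (x : M) (p : R -> M) (v : 'rV[R]_(dim M)) : Prop :=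
  (\forall s \near (0 : R)^', cdom (chart_at x) (p s)) /\
  s^-1 *: (cmap (chart_at x) (p s) - cmap (chart_at x) x)
    @[s --> (0 : R)^'] --> v.

Lemma tangent_path_cvg M (x : M) p v : tangent_path x p v ->
  cmap (chart_at x) (p s) @[s --> (0 : R)^'] --> cmap (chart_at x) x.
Proof.
move=> [_ pv]; pose k := chart_at x.
have : cmap k x + s *: (s^-1 *: (cmap k (p s) - cmap k x))
    @[s --> (0 : R)^'] --> cmap k x + (0 : R) *: v.
  by apply: cvgD (cvg_cst _) _; apply: cvgZ pv; exact: dnbhs0_id.
rewrite scale0r addr0; apply: cvg_trans; apply: near_eq_cvg.
near=> s; have s0 : s != 0 by near: s; exact: nbhs_dnbhs_neq.
by rewrite scalerA divff// scale1r addrC subrK.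
Unshelve. all: by end_near.
Qed.

Lemma tangent_path_cst M (x : M) : tangent_path x (fun=> x) 0.
Proof.
split; first by apply: nearW => _; exact: chart_at_dom.
by under eq_fun do rewrite subrr scaler0; exact: cvg_cst.
Qed.

(** The infinitesimal form of the distance: the velocities of two paths through
    [x] bound their distance up to [o(s)]. *)
Lemma rdist_tangent_path M (e : metric M) x p q a b r :
  tangent_path x p a -> tangent_path x q b ->
  Num.sqrt (e x (b - a) (b - a)) < r ->
  \forall s \near (0 : R)^', (rdist e (p s) (q s) <= (`|s| * r)%:E)%E.
Proof.
move=> pa qb; have px := tangent_path_cvg pa.
case: pa qb => kp pa [kq qb]; pose k := chart_at x; have kx := chart_at_dom x.
rewrite -[e x _ _](_ : chart_ip e k (cmap k x) (b - a) (b - a) = _); last first.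
  by rewrite /chart_ip cmapK// !chart_vector_own.
move=> lt_r.
have qp : s^-1 *: (cmap k (q s) - cmap k (p s)) @[s --> (0 : R)^'] --> b - a.
  have : s^-1 *: (cmap k (q s) - cmap k x) - s^-1 *: (cmap k (p s) - cmap k x)
      @[s --> (0 : R)^'] --> b - a by exact: cvgB.
  by under eq_fun do rewrite -scalerBr opprB addrA subrK.
have := rdist_near (chart_at_atlas x) kx px qp lt_r.
by apply: filterS3 kp kq => s kps kqs; rewrite !cmapK.
Unshelve. all: by end_near.
Qed.

Lemma tangent_path_smooth M N (f : M -> N) (g : M) (W : 'rV[R]_(dim M)) :
  smooth f ->
  tangent_path (f g)
    (fun s : R => f (cinv (chart_at g) (s *: W + cmap (chart_at g) g)))
    (mdiff f g W).
Proof.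
move=> sf; pose q := cmap (chart_at g) g.
have df := chart_at_diff g sf; split.
  have near_f : \forall h \near g, cdom (chart_at (f g)) (f h).
    by apply: sf.1; exact: near_cdom (chart_at_dom _).
  have /= near_q := near_cinv (chart_at_dom g) near_f.
  have path_cvg : s *: W + q @[s --> (0 : R)^'] --> q.
    have : s *: W + q @[s --> (0 : R)^'] --> (0 : R) *: W + q.
      by apply: cvgD (cvg_cst _); apply: cvgZ (cvg_cst _); exact: dnbhs0_id.
    by rewrite scale0r add0r.
  exact: path_cvg _ near_q.
have dE := deriveE W df; rewrite /mdiff -dE.
have := @diff_derivable _ _ _ _ _ W df.
rewrite /derivable /derive /= cmapK//; exact: chart_at_dom.
Qed.

Lemma tangent_path_curve M (c : R -> M) (t : R) :
  smooth_curve c -> `[0, 1]%classic t ->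
  tangent_path (c t) (fun s => c (s + t)) (velocity c t).
Proof.
move=> sc t01; have ak := chart_at_atlas (c t); have kt := chart_at_dom (c t).
have [_ near_k] := smooth_curve_chart sc t01 ak kt.
have [_ ct dt] := nbhs_singleton near_k; split.
  have shift_cvg : s + t @[s --> (0 : R)^'] --> t.
    rewrite -[X in _ --> X]add0r.
    by apply: cvgD; [exact: dnbhs0_id|exact: cvg_cst].
  have kc : \forall b \near t, cdom (chart_at (c t)) (c b).
    by apply: filterS near_k => b [].
  exact: shift_cvg _ kc.
have := @diff_derivable _ _ _ _ _ (1 : R^o) dt.
rewrite /derivable /velocity derive1E /derive /=.
by under eq_fun do rewrite [_ *: 1]mulr1.
Qed.

End TangentPaths.

(** * Normal parts of tangent vectors *)

Section NormalPart.
Context {R : realType}.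

(** The normal equations for projecting [v] to the row space of [P] have the
    matrix [P *m Q *m P^T].  They are solvable because a vector [z] in the
    kernel of this matrix satisfies [z^T P Q P^T z = 0], hence [P^T z = 0]. *)
Lemma orthogonal_projection (F : realFieldType) m n (P : 'M[F]_(m, n))
    (Q : 'M[F]_n) (v : 'rV[F]_n) :
  (forall u : 'rV[F]_n, u != 0 -> 0 < (u *m Q *m u^T) 0 0) ->
  exists l : 'rV[F]_m, (v - l *m P) *m Q *m P^T = 0.
Proof.
move=> Qpos; pose A := P *m Q *m P^T.
have PZ (Z : 'M[F]_m) : A *m Z = 0 -> P^T *m Z = 0.
  move=> AZ; apply/trmx_inj/row_matrixP => i.
  rewrite trmx_mul trmxK trmx0 row0 row_mul.
  apply/eqP/negPn/negP => /Qpos; rewrite trmx_mul tr_row trmxK colE.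
  set r := row i Z^T; set d := delta_mx i 0.
  have -> : r *m P *m Q *m (P^T *m (Z *m d)) = r *m (A *m Z) *m d.
    by rewrite /A !mulmxA.
  by rewrite AZ mulmx0 mul0mx mxE ltxx.
have : (v *m Q *m P^T <= A)%MS.
  have PC : P^T *m cokermx A = 0 by apply: PZ; exact: mulmx_coker.
  rewrite submxE -(mulmxA (v *m Q)).
  by rewrite PC mulmx0.
case/submxP => l lE; exists l.
by rewrite !mulmxBl lE /A !mulmxA subrr.
Qed.

Context {G : lie_groupoid R}.
Implicit Types e : metric (obj G).

Definition gram e x : 'M[R]_(dim (obj G)) :=
  \matrix_(i, j) e x (delta_mx 0 i) (delta_mx 0 j).

Lemma gramE e x (u v : tangent (obj G)) : (u *m gram e x *m v^T) 0 0 = e x u v.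
Proof.
rewrite {2}(row_sum_delta u) ip_suml -mulmxA mxE; apply: eq_bigr => i _.
rewrite ipZ; congr (_ * _); rewrite ip_sym {2}(row_sum_delta v) ip_suml mxE.
by apply: eq_bigr => j _; rewrite ipZ !mxE mulrC ip_sym.
Qed.

(** The matrix is the kernel of [d src] followed by [d tgt], read off the
    definition of the tangent space of the orbit. *)
Lemma orbit_tangentP (x : obj G) : exists m (P : 'M[R]_(m, dim (obj G))),
  forall w, orbit_tangent x w <-> exists l, w = l *m P.
Proof.
pose S : {linear 'rV[R]_(dim (arr G)) -> 'rV[R]_(dim (obj G))} :=
  'd (cmap (chart_at (src G (gunit G x))) \o src G
        \o cinv (chart_at (gunit G x)))
     (cmap (chart_at (gunit G x)) (gunit G x)).
pose T : {linear 'rV[R]_(dim (arr G)) -> 'rV[R]_(dim (obj G))} :=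
  'd (cmap (chart_at (tgt G (gunit G x))) \o tgt G
        \o cinv (chart_at (gunit G x)))
     (cmap (chart_at (gunit G x)) (gunit G x)).
exists _, (kermx (lin1_mx S) *m lin1_mx T) => w; split.
  case=> v /= Sv <-.
  have /sub_kermxP/submxP[l lE] : v *m lin1_mx S = 0 by rewrite mul_rV_lin1.
  by exists l; rewrite mulmxA -lE mul_rV_lin1.
case=> l ->; exists (l *m kermx (lin1_mx S)).
  by rewrite /= -[LHS](mul_rV_lin1 S) -mulmxA mulmx_ker mulmx0.
by rewrite (mulmxA l (kermx _) (lin1_mx T)) (mul_rV_lin1 T).
Qed.

Lemma normal_part_exists e x (v : tangent (obj G)) :
  exists u, normal_part e x v u.
Proof.
have [m [P PE]] := orbit_tangentP x.
have [u|l lE] := @orthogonal_projection _ _ _ P (gram e x) v.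
  by rewrite gramE; exact: ip_pos.
exists (v - l *m P); split.
  by apply/PE; exists l; rewrite opprB addrC subrK.
move=> w /PE[l' ->]; rewrite -gramE trmx_mul mulmxA lE mul0mx.
by rewrite mxE.
Qed.

(** The class of [v] in the normal space has the same norm for both metrics.
    Let [u] be its representative which is normal for [e2]; for [e1] this norm
    is the one of the normal part of [v], which is at most the one of [v]. *)
Lemma normal_part_le e1 e2 x (v : tangent (obj G)) :
  equivalent_metrics e1 e2 ->
  exists2 u, orbit_tangent x (v - u) & e2 x u u <= e1 x v v.
Proof.
move=> e12; have [u1 [vu1 u1N]] := normal_part_exists e1 x v.
have /e12 : normal_ip e1 x v v (e1 x u1 u1) by exists u1, u1.
case=> u [u' [[vu uN] [vu' u'N] uu']]; exists u => //.
have -> : e2 x u u = e1 x u1 u1.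
  have [m [P PE]] := orbit_tangentP x.
  have uu'T : orbit_tangent x (u' - u).
    have [l lE] := (PE _).1 vu; have [l' l'E] := (PE _).1 vu'.
    apply/PE; exists (l - l'); rewrite mulmxBl -lE -l'E.
    by rewrite opprB [RHS]addrC addrA subrK.
  rewrite -uu'; have := uN _ uu'T; rewrite ip_sym ipD -scaleN1r ipZ mulN1r.
  by move=> /eqP; rewrite subr_eq0 => /eqP <-; rewrite ip_sym.
have v1 := u1N _ vu1; rewrite -(subrK u1 v).
move: (v - u1) v1 => w v1.
have -> : e1 x (w + u1) (w + u1) = e1 x w w + e1 x u1 u1.
  rewrite ipD (ip_sym e1 x w) (ip_sym e1 x u1 (w + u1)) !ipD v1.
  by rewrite (ip_sym e1 x w u1) v1 addr0 add0r.
by rewrite lerDr ip_ge0.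
Qed.

End NormalPart.

(** * Comparison of two equivalent metrics *)

Section Comparison.
Context {R : realType}.

(** The supremum of the [a] with [P 0 a] satisfies [P 0] by the local property on
    its left, and is 1 because of the local property on its right. *)
Lemma interval_chaining (P : R -> R -> Prop) :
  (forall a b d, 0 <= a -> a <= b -> b <= d -> d <= 1 ->
    P a b -> P b d -> P a d) ->
  (forall t, `[0, 1]%classic t -> exists2 d, 0 < d &
    (forall a, 0 <= a -> a <= t -> t - d < a -> P a t) /\
    (forall b, t <= b -> b <= 1 -> b < t + d -> P t b)) ->
  P 0 1.
Proof.
move=> tr loc; pose A := [set a | [/\ 0 <= a, a <= 1 & P 0 a]].
have A0 : A 0.
  have [|d d0 [_ P0]] := loc 0; first by rewrite /= in_itv/= lexx ler01.
  by split => //; apply: P0 => //; rewrite add0r.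
have hsA : has_sup A by split; [exists 0|exists 1 => a []].
have s0 : 0 <= sup A by exact: ub_le_sup hsA.2 _ A0.
have s1 : sup A <= 1 by apply: ge_sup => [|a []//]; exists 0.
have [|d d0 [Pl Pr]] := loc (sup A); first by rewrite /= in_itv/= s0 s1.
have P0s : P 0 (sup A).
  have [a [a0 a1 Pa] lt_a] := sup_adherent d0 hsA.
  have a_s : a <= sup A by apply: ub_le_sup hsA.2 _ _.
  by apply: (tr 0 a) => //; exact: Pl.
have [s_eq1|s_neq1] := eqVneq (sup A) 1; first by rewrite -s_eq1.
have s_lt1 : sup A < 1 by rewrite lt_neqAle s_neq1.
pose b := Num.min 1 (sup A + d / 2).
have s_lt_b : sup A < b by rewrite lt_min s_lt1 ltrDl divr_gt0.
have b1 : b <= 1 by rewrite ge_min lexx.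
have b_lt : b < sup A + d.
  by rewrite gt_min orbC ltrD2l ltr_pdivrMr// ltr_pMr ?ltr1n.
suff Ab : A b by have := ub_le_sup hsA.2 Ab; rewrite leNgt s_lt_b.
have Psb : P (sup A) b by apply: Pr => //; exact: ltW.
split=> //; first exact: le_trans s0 (ltW s_lt_b).
by apply: tr P0s Psb => //; exact: ltW.
Qed.

Lemma integral_speed_ge (M : manifold R) (e : metric M) (c : R -> M)
    (a b m : R) :
  smooth_curve c -> 0 <= a -> a <= b -> b <= 1 -> 0 <= m ->
  (forall s, a < s -> s <= b -> m <= speed e c s) ->
  ((m * (b - a))%:E <=
     \int[lebesgue_measure]_(s in `]a, b]) (speed e c s)%:E)%E.
Proof.
move=> sc a0 ab b1 m0 ge_m.
have -> : ((m * (b - a))%:E =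
    \int[lebesgue_measure]_(s in `]a, b]) (cst m%:E s))%E.
  rewrite integral_cst//= lebesgue_measure_itv/= lte_fin.
  by move: ab; rewrite le_eqVlt => /orP[/eqP->|->];
    rewrite ?ltxx ?subrr ?mulr0 ?mule0.
apply: ge0_le_integral => //.
  apply/measurable_EFinP; apply: (speed_measurable e sc) => // s.
  rewrite /= !in_itv/= => /andP[lt_as le_sb].
  by rewrite (le_trans a0 (ltW lt_as)) (le_trans le_sb).
by move=> s; rewrite /= in_itv/= lee_fin => /andP[]; exact: ge_m.
Qed.

Context {G : lie_groupoid R}.
Implicit Types e : metric (obj G).

(** If [v - u = d tgt w] with [d src w = 0], then the infinitesimal arrow
    [W = d unit v - w] leads from [v] to [u]. *)
Lemma orbit_slide (x : obj G) (v u : tangent (obj G)) :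
  orbit_tangent x (v - u) ->
  exists W : 'rV[R]_(dim (arr G)),
    mdiff (src G) (gunit G x) W = v /\ mdiff (tgt G) (gunit G x) W = u.
Proof.
case=> w /= sw tw; exists (mdiff (gunit G) x v - w).
have mdiffB (f : arr G -> obj G) g a b :
    mdiff f g (a - b) = mdiff f g a - mdiff f g b.
  exact: linearB.
have unitK (f : arr G -> obj G) : smooth f -> (forall y, f (gunit G y) = y) ->
    mdiff f (gunit G x) (mdiff (gunit G) x v) = v.
  move=> sf fK; rewrite -(mdiff_comp _ _ (unit_smooth G) sf).
  by rewrite (_ : f \o gunit G = id) ?mdiff_id//; apply/funext.
have sv := unitK _ (src_submersion G).1 (@src_unit _ G).
have tv := unitK _ (tgt_submersion G).1 (@tgt_unit _ G).
by rewrite !mdiffB sw tw sv tv subr0 opprB addrC subrK.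
Qed.

(** A path of arrows [g s] with velocity [W] as above at the unit of [c t] gives
    the chain [c t, tgt (g s) ~ src (g s), c (s + t)].  The first move costs
    about the norm of [s u], and the second one [o(s)], since [src (g s)] and
    [c (s + t)] have the same velocity.  The two bounds serve the times after
    and before [t]. *)
Lemma chain_inf_slide e (c : R -> obj G) (t : R) u (r : R) :
  smooth_curve c -> `[0, 1]%classic t ->
  orbit_tangent (c t) (velocity c t - u) -> Num.sqrt (e (c t) u u) < r ->
  \forall s \near (0 : R)^',
    (chain_inf e (c t) (c (s + t)%R) <= (`|s| * r)%:E)%E /\
    (chain_inf e (c (s + t)%R) (c t) <= (`|s| * r)%:E)%E.
Proof.
move=> sc t01 /orbit_slide[W [sW tW]] lt_r; set x := c t in sW tW lt_r *.
pose g s := cinv (chart_at (gunit G x))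
  (s *: W + cmap (chart_at (gunit G x)) (gunit G x)).
have ts : tangent_path x (src G \o g) (velocity c t).
  rewrite -sW -{1}[x](src_unit x); apply: tangent_path_smooth.
  exact: (src_submersion G).1.
have tt : tangent_path x (tgt G \o g) u.
  rewrite -tW -{1}[x](tgt_unit x); apply: tangent_path_smooth.
  exact: (tgt_submersion G).1.
have tc := tangent_path_curve sc t01.
have t0 := tangent_path_cst x.
have [r1 n_r1 r1_r] : exists2 r1, Num.sqrt (e x u u) < r1 & r1 < r.
  by exists ((Num.sqrt (e x u u) + r) / 2); rewrite ?midf_lt.
pose r2 := r - r1; have r2_gt0 : 0 < r2 by rewrite subr_gt0.
have sqrt0 : Num.sqrt (e x (velocity c t - velocity c t)
                           (velocity c t - velocity c t)) < r2.
  by rewrite subrr ip0 sqrtr0.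
have sqrtu : Num.sqrt (e x (u - 0) (u - 0)) < r1 by rewrite subr0.
have sqrtNu : Num.sqrt (e x (0 - u) (0 - u)) < r1.
  by rewrite sub0r -scaleN1r ipZ ipZr mulrA mulN1r opprK mul1r.
have := rdist_tangent_path t0 tt sqrtu.
have := rdist_tangent_path tt t0 sqrtNu.
have := rdist_tangent_path ts tc sqrt0.
have := rdist_tangent_path tc ts sqrt0.
move=> near_cs near_sc near_tx near_xt; near=> s.
have src_tgt : same_orbit (src G (g s)) (tgt G (g s)) by exists (g s).
have le_r y z : (chain_inf e y z <= (`|s| * r1)%:E + (`|s| * r2)%:E ->
    chain_inf e y z <= (`|s| * r)%:E)%E.
  by rewrite -EFinD -mulrDr /r2 addrC subrK.
split; apply: le_r.
  apply: le_trans (chain_inf_trans _ _ (tgt G (g s)) _) _; apply: leeD.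
    by apply: le_trans (chain_inf_rdist _ _ _) _; near: s; exact: near_xt.
  apply: le_trans (chain_inf_trans _ _ (src G (g s)) _) _.
  rewrite -[leRHS]add0e.
  apply: leeD; first exact/chain_inf_orbit/same_orbit_sym.
  by apply: le_trans (chain_inf_rdist _ _ _) _; near: s; exact: near_sc.
rewrite addeC; apply: le_trans (chain_inf_trans _ _ (src G (g s)) _) _.
apply: leeD.
  by apply: le_trans (chain_inf_rdist _ _ _) _; near: s; exact: near_cs.
apply: le_trans (chain_inf_trans _ _ (tgt G (g s)) _) _; rewrite -[leRHS]add0e.
apply: leeD; first exact/chain_inf_orbit.
by apply: le_trans (chain_inf_rdist _ _ _) _; near: s; exact: near_tx.
Unshelve. all: by end_near.
Qed.

Lemma chain_inf_speed e1 e2 (c : R -> obj G) (t d : R) :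
  equivalent_metrics e1 e2 -> smooth_curve c -> `[0, 1]%classic t -> 0 < d ->
  \forall b \near t,
    (chain_inf e2 (c t) (c b) <= (`|b - t| * (speed e1 c t + d))%:E)%E /\
    (chain_inf e2 (c b) (c t) <= (`|b - t| * (speed e1 c t + d))%:E)%E.
Proof.
move=> e12 sc t01 d0.
have [u vu le_u] := normal_part_le (c t) (velocity c t) e12.
have lt_u : Num.sqrt (e2 (c t) u u) < speed e1 c t + d.
  by apply: le_lt_trans (_ : _ <= speed e1 c t) _; rewrite ?ltrDl// ler_wsqrtr.
(* punctured neighborhoods unfold to an implication *)
have : \forall s \near (0 : R), s != 0 -> _ := chain_inf_slide sc t01 vu lt_u.
rewrite (near_shift 0 t); apply: filterS => s; rewrite /= subr0 addrK => slide.
have [->|s0] := eqVneq s 0; last exact: slide.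
rewrite add0r normr0 mul0r.
by split; apply: chain_inf_orbit; exact: same_orbit_refl.
Qed.


(** On each interval the cost is compared with the integral of the speed, with
    an error [d] per unit of time.  Around a fixed time [t] half of [d] pays for
    the variation of the speed, the other half for the error in
    [chain_inf_speed]; such intervals chain up to [[0, 1]]. *)
Lemma chain_inf_curve e1 e2 (c : R -> obj G) :
  equivalent_metrics e1 e2 -> smooth_curve c ->
  (chain_inf e2 (c 0%R) (c 1%R) <= curve_length e1 c)%E.
Proof.
move=> e12 sc; apply/lee_addgt0Pr => d d0.
pose cost (a b : R) : \bar R :=
  (\int[lebesgue_measure]_(s in `]a, b]) (speed e1 c s)%:E +
     (d * (b - a))%:E)%E.
have le_cost a b r : 0 <= a -> a <= b -> b <= 1 ->
    (forall s, a < s -> s <= b -> r - d <= speed e1 c s) ->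
    (((b - a) * r)%:E <= cost a b)%E.
  move=> a0 ab b1 ge_r; pose m := Num.max 0 (r - d).
  have ge_m s : a < s -> s <= b -> m <= speed e1 c s.
    by move=> lt_as le_sb; rewrite ge_max sqrtr_ge0 ge_r.
  have m0 : 0 <= m by rewrite le_max lexx.
  apply: le_trans (leeD (integral_speed_ge sc a0 ab b1 m0 ge_m) (lexx _)).
  have le_m : r - d <= m by rewrite le_max lexx orbT.
  rewrite -EFinD lee_fin -mulrDl mulrC ler_wpM2r ?subr_ge0//; lra.
suff : (chain_inf e2 (c 0%R) (c 1%R) <= cost 0%R 1%R)%E.
  move/le_trans; apply; rewrite /cost subr0 mulr1; apply: leeD => //.
  apply: ge0_subset_integral => //.
  - by apply/measurable_EFinP; exact: (speed_measurable e1 sc).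
  - by move=> s _; rewrite lee_fin sqrtr_ge0.
  - by move=> s; rewrite /= !in_itv/= => /andP[/ltW ->].
apply: (@interval_chaining
  (fun a b => (chain_inf e2 (c a) (c b) <= cost a b)%E)).
  move=> a b f a0 ab bf f1 Pab Pbf.
  apply: le_trans (chain_inf_trans _ _ (c b) _) _.
  apply: le_trans (leeD Pab Pbf) _.
  have -> : cost a f = (cost a b + cost b f)%E.
    rewrite /cost addeACA -EFinD -mulrDr.
    congr (_ + (d * _)%:E)%E; last by ring.
    rewrite (@itv_bndbnd_setU _ _ (BRight a) (BRight b) (BRight f)) ?bnd_simp//.
    rewrite ge0_integral_setU//.
    - rewrite -itv_bndbnd_setU ?bnd_simp//; apply/measurable_EFinP.
      apply: (speed_measurable e1 sc) => // s.
      rewrite /= !in_itv/= => /andP[lt_as le_sf].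
      by rewrite (le_trans a0 (ltW lt_as)) (le_trans le_sf).
    - by move=> s _; rewrite lee_fin sqrtr_ge0.
    - apply/disj_setPS => s [].
      rewrite /= !in_itv/= => /andP[_ le_sb] /andP[lt_bs _].
      by move: lt_bs; rewrite ltNge le_sb.
  by [].
move=> t t01.
have near_c := chain_inf_speed e12 sc t01 (divr_gt0 d0 (ltr0n _ 2)).
have near_s : \forall b \near t, speed e1 c t - d / 2 < speed e1 c b.
  have lt_t : speed e1 c t - d / 2 < speed e1 c t.
    by rewrite gtrDl oppr_lt0 divr_gt0.
  have cont_t : speed e1 c b @[b --> t] --> speed e1 c t.
    exact: speed_continuous.
  exact: cvgr_gt _ cont_t _ lt_t.
have half : speed e1 c t + d / 2 - d = speed e1 c t - d / 2.
  by rewrite [X in _ - X]splitr opprD addrA addrK.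
have /nbhs_ballP[q /= q0 qP] := @filterI _ _ (nbhs_filter t) _ _ near_c near_s.
exists q => //; split.
  move=> a a0 at_ lt_a.
  have t1 : t <= 1 by move: t01; rewrite /= in_itv/= => /andP[].
  have [|[_ le_ct] _] := qP a.
    by rewrite -ball_normE/= ger0_norm ?subr_ge0// ltrBlDr -ltrBlDl.
  apply: le_trans le_ct _; rewrite distrC ger0_norm ?subr_ge0//.
  apply: le_cost => // s lt_as le_st.
  have [|_ lt_s] := qP s; last by rewrite half ltW.
  rewrite -ball_normE/= ger0_norm ?subr_ge0// ltrBlDr -ltrBlDl.
  exact: lt_trans lt_a lt_as.
move=> b tb b1 lt_b.
have t0 : 0 <= t by move: t01; rewrite /= in_itv/= => /andP[].
have [|[le_ct _] _] := qP b.
  by rewrite -ball_normE/= distrC ger0_norm ?subr_ge0// ltrBlDl.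
apply: le_trans le_ct _; rewrite ger0_norm ?subr_ge0//.
apply: le_cost => // s lt_ts le_sb.
have [|_ lt_s] := qP s; last by rewrite half ltW.
rewrite -ball_normE/= distrC ger0_norm ?subr_ge0 ?(ltW lt_ts)// ltrBlDl.
exact: le_lt_trans le_sb lt_b.
Qed.

Lemma chain_inf_piecewise e1 e2 (x y : obj G) cs :
  equivalent_metrics e1 e2 -> piecewise_smooth x cs y ->
  (chain_inf e2 x y <= \sum_(c <- cs) curve_length e1 c)%E.
Proof.
move=> e12; elim: cs x => [|c cs IH] x /=.
  by move=> ->; rewrite big_nil; apply: chain_inf_orbit; exact: same_orbit_refl.
case=> <- sc /IH le_cs; rewrite big_cons.
apply: le_trans (chain_inf_trans _ _ (c 1) _) _.
by apply: leeD => //; exact: chain_inf_curve.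
Qed.

Lemma chain_inf_equivalent e1 e2 (x y : obj G) :
  equivalent_metrics e1 e2 -> (chain_inf e2 x y <= chain_inf e1 x y)%E.
Proof.
move=> e12; apply: le_ereal_inf_tmp => _ [n [xs [[x0 yn orb _] ->]]].
have le_rdist a b : (chain_inf e2 a b <= rdist e1 a b)%E.
  by apply: le_ereal_inf_tmp => _ [cs /= ab <-]; exact: chain_inf_piecewise ab.
have le_even i : (i <= n)%N ->
    (chain_inf e2 x (xs i.*2.+1) <=
       \sum_(1 <= j < i.+1) rdist e1 (xs j.*2.-1) (xs j.*2))%E.
  elim: i => [|i IH] le_in.
    by rewrite big_geq// -x0; apply: chain_inf_orbit; exact: (orb 0%N).
  rewrite big_nat_recr//=.
  apply: le_trans (chain_inf_trans _ _ (xs i.*2.+1) _) _.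
  apply: leeD; first exact: IH (ltnW le_in).
  apply: le_trans (chain_inf_trans _ _ (xs i.+1.*2) _) _; rewrite -[leRHS]adde0.
  apply: leeD; first exact: le_rdist.
  by apply: chain_inf_orbit; exact: orb.
by rewrite -yn; exact: le_even.
Qed.

End Comparison.

Theorem corollary3p11 (R : realType) (G : lie_groupoid R)
  (eta1 eta2 : groupoid_metric G)
  (eta1_1 eta2_1 : metric (arr G)) (eta1_0 eta2_0 : metric (obj G)) :
  induced_metrics eta1 eta1_1 eta1_0 ->
  induced_metrics eta2 eta2_1 eta2_0 ->
  equivalent_metrics eta1_0 eta2_0 ->
  forall a b : orbit_space G,
    normal_dist eta1_0 a b = normal_dist eta2_0 a b.
Proof.
move=> _ _ e12 a b; rewrite /normal_dist; apply/eqP; rewrite eq_le.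
have e21 : equivalent_metrics eta2_0 eta1_0 by move=> x u v r; split=> /e12.
by apply/andP; split; exact: chain_inf_equivalent.
Qed.
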